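(* Let $E$ be a normed space (over $\mathbb{R}$ or $\mathbb{C}$), let $[a,b]$ be a compact interval with $a<b$, and let $1\le p\le q<+\infty$. Let $f\colon E\to E$ be a map such that the composition operator $C_f$ generated by $f$ maps $BV_p([a,b],E)$ into $BV_q([a,b],E)$. Then the operator $C_f\colon BV_p([a,b],E)\to BV_q([a,b],E)$ is locally bounded if and only if $f$ is Hölder continuous on bounded subsets of $E$ with exponent $p/q$.
   Context: $E$ is a normed space over the real or complex numbers with norm $\|\cdot\|_E$; it is not assumed complete. For $p\in[1,+\infty)$, a map $x\colon[a,b]\to E$ and a subinterval $[c,d]\subseteq[a,b]$, the $p$-variation (Wiener variation) of $x$ over $[c,d]$ is the possibly infinite quantity $$\operatorname{var}_p(x,[c,d])=\sup\sum_{i=1}^n\|x(t_i)-x(t_{i-1})\|_E^p,$$ where the supremum is over all finite partitions $c=t_0<t_1<\dots<t_n=d$ of $[c,d]$. $BV_p([a,b],E)$ denotes the set of all maps $x\colon[a,b]\to E$ with $\operatorname{var}_p(x,[a,b])<+\infty$; it is a normed space under the norm $\|x\|_p=\|x(a)\|_E+(\operatorname{var}_p(x,[a,b]))^{1/p}$. The composition operator $C_f$ generated by $f\colon E\to E$ assigns to a map $x\colon[a,b]\to E$ the map $C_f(x)\colon[a,b]\to E$ given by $C_f(x)(t)=f(x(t))$. The operator $C_f\colon BV_p([a,b],E)\to BV_q([a,b],E)$ is called locally bounded if it maps bounded subsets of $BV_p([a,b],E)$ (with respect to $\|\cdot\|_p$) to bounded subsets of $BV_q([a,b],E)$ (with respect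 to $\|\cdot\|_q$). Continuity of $C_f$ is not assumed. For $\alpha\in(0,1]$, a map $f\colon E\to E$ is Hölder continuous on bounded subsets of $E$ with exponent $\alpha$ if for every bounded set $K\subseteq E$ there exists a constant $L_K\ge0$ such that $\|f(u)-f(w)\|_E\le L_K\|u-w\|_E^\alpha$ for all $u,w\in K$. *)

(* Defs.v *)
From HB Require Import structures.
From mathcomp Require Import all_boot all_order all_algebra.
From mathcomp Require Import all_classical all_reals all_analysis.
From mathcomp Require Import complex.
Set Implicit Arguments.
Unset Strict Implicit.
Unset Printing Implicit Defensive.
Import Order.TTheory GRing.Theory Num.Theory.
Import numFieldNormedType.Exports.
Local Open Scope classical_set_scope.
Local Open Scope ring_scope.

(* The library norm of a [normedModType K] takes its values in [K]; these are
   the corresponding norms with values in [R], for [K = R] and [K = R[i]].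
   In the complex case [`|v|] is a nonnegative element of [R[i]], hence equal
   to its own real part. *)
Definition norm_real (R : realType) (E : normedModType R) (v : E) : R := `|v|.
Definition norm_complex (R : realType) (E : normedModType R[i]) (v : E) : R :=
  complex.Re `|v|.

Section WienerVariation.
Context {R : realType} {E : zmodType}.
(* The real-valued norm of E: [@norm_real R E] or [@norm_complex R E]. *)
Variable N : E -> R.
Implicit Types (p q a b c d : R) (s : seq R) (x : R -> E).

(* As in the library, the partition c = t_0 < t_1 < ... < t_n = d is encoded by
   the sequence s = [:: t_1; ...; t_n], with [itv_partition c d s]. *)
Definition pvariation p c d x s : R :=
  let t := nth d (c :: s) in
  \sum_(0 <= i < size s) N (x (t i.+1) - x (t i)) `^ p.

Definition var p c d x : \bar R :=
  ereal_sup [set (pvariation p c d x s)%:E | s in itv_partition c d].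

(* As for [bounded_variation] in the library, a map on [a, b] is represented by
   a function on R, of which only the values on [a, b] matter. *)
Definition BVp p a b : set (R -> E) := [set x | (var p a b x < +oo)%E].

(* Only meaningful on [BVp p a b], since [fine +oo = 0]. *)
Definition BVp_norm p a b x : R := N (x a) + fine (var p a b x) `^ p^-1.

Definition BVp_bounded p a b (A : set (R -> E)) : Prop :=
  A `<=` BVp p a b /\ exists M : R, forall x, A x -> BVp_norm p a b x <= M.

Definition comp_op (f : E -> E) x : R -> E := fun t => f (x t).

Definition locally_bounded_op p q a b (F : (R -> E) -> (R -> E)) : Prop :=
  forall A : set (R -> E), BVp_bounded p a b A -> BVp_bounded q a b (F @` A).

End WienerVariation.

Definition hoelder_on_bounded (R : realType) (K : numFieldType)
    (E : normedModType K) (N : E -> R) (alpha : R) (f : E -> E) : Prop :=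
  forall A : set E, bounded_set A ->
    exists2 L : R, 0 <= L &
      forall u w, A u -> A w -> N (f u - f w) <= L * N (u - w) `^ alpha.

(* Main.v *)
Require Import Defs.
From HB Require Import structures.
From mathcomp Require Import all_boot all_order all_algebra.
From mathcomp Require Import all_classical all_reals all_analysis.
From mathcomp Require Import complex.
From mathcomp Require Import ring lra.
Set Implicit Arguments.
Unset Strict Implicit.
Unset Printing Implicit Defensive.
Import Order.TTheory GRing.Theory Num.Theory.
Import numFieldNormedType.Exports.
Local Open Scope classical_set_scope.
Local Open Scope ring_scope.

(** Write N for the norm of E.

    Hoelder implies locally bounded: a map x with ||x||_p <= M takes its
    values in the ball of radius M ([BVp_norm_ub]).  If f is Hoelder there
    with constant L and exponent p / q, then every term of a q-variation sum
    of f o x satisfies N (f (x t) - f (x s)) ^ q <= L ^ q * N (x t - x s) ^ p,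
    so that var_q (f o x) <= L ^ q * var_p x ([var_comp_hoelder]).

    Locally bounded implies Hoelder: let u != w lie in the ball of radius r and
    put d = N (u - w), so that d <= 2r.  A map that jumps n times between u and
    w ([zigzag]) has p-variation at most n d ^ p, whereas its image under f has
    q-variation at least n N (f u - f w) ^ q.  Take n to be the integer part of
    (2r / d) ^ p; it is at least 1.  Then the zigzag has
    p-norm at most 3r, whatever u and w are, so local boundedness gives an M
    depending on r alone with n N (f u - f w) ^ q <= M ^ q.  As n is at least
    half of (2r / d) ^ p, this reads
    N (f u - f w) ^ q <= 2 M ^ q (2r) ^ (- p) d ^ p, which is the Hoelder
    condition.

    Only the additive structure of E and the norm axioms are involved, so the
    argument is carried out once for an abstract real-valued norm
    ([is_norm]) and then applied to the real and the complex cases. *)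

(** * Powers with real exponents *)

Section PowerLemmas.
Context {R : realType}.
Implicit Types x y p : R.

Lemma powRK x p : 0 <= x -> p != 0 -> (x `^ p) `^ p^-1 = x.
Proof. by move=> x0 p0; rewrite -powRrM mulfV// powRr1. Qed.

Lemma powRVK x p : 0 <= x -> p != 0 -> (x `^ p^-1) `^ p = x.
Proof. by move=> x0 p0; rewrite -powRrM mulVf// powRr1. Qed.

Lemma le_powR x y p : 0 <= p -> 0 <= x -> x <= y -> x `^ p <= y `^ p.
Proof.
by move=> p0 x0 xy; rewrite ge0_ler_powR// nnegrE// (le_trans x0).
Qed.

Lemma le_powR_root x y p : 0 < p -> 0 <= x -> x `^ p <= y -> x <= y `^ p^-1.
Proof.
move=> p0 x0 xy; rewrite -(powRK x0 (lt0r_neq0 p0)).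
by apply: le_powR => //; rewrite ?invr_ge0 ?powR_ge0// ltW.
Qed.

Lemma powR_root_le x y p : 0 < p -> 0 <= x -> x `^ p^-1 <= y -> x <= y `^ p.
Proof.
move=> p0 x0 xy; rewrite -(powRVK x0 (lt0r_neq0 p0)).
by apply: le_powR => //; rewrite ?powR_ge0// ltW.
Qed.

Lemma le_powR_cancel x y p : 0 < p -> 0 <= x -> 0 <= y ->
  x `^ p <= y `^ p -> x <= y.
Proof.
move=> p0 x0 y0 /(le_powR_root p0 x0).
by rewrite powRK// lt0r_neq0.
Qed.

End PowerLemmas.

(** * Variation with respect to an abstract norm *)

Record is_norm (R : realType) (E : zmodType) (N : E -> R) : Prop := IsNorm {
  normN0 : N 0 = 0 ;
  normN0_eq0 : forall v, N v = 0 -> v = 0 ;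
  normN_ge0 : forall v, 0 <= N v ;
  normNN : forall v, N (- v) = N v ;
  normND : forall u v, N (u + v) <= N u + N v }.

Section Variation.
Context {R : realType} {E : zmodType} {N : E -> R}.
Hypothesis normN : is_norm N.
Implicit Types (a b p q r : R) (x : R -> E) (f : E -> E) (u w : E).

Lemma pvariation_le_var p a b x s : itv_partition a b s ->
  ((pvariation N p a b x s)%:E <= var N p a b x)%E.
Proof. by move=> abs; apply: ereal_sup_ubound; exists s. Qed.

Lemma pvariation_ge0 p a b x s : 0 <= pvariation N p a b x s.
Proof. by apply: sumr_ge0 => i _; exact: powR_ge0. Qed.

Lemma var_ge0 p a b x : a < b -> (0 <= var N p a b x)%E.
Proof.
move=> ab; apply: le_trans (pvariation_le_var p x (itv_partition1 ab)).
by rewrite lee_fin pvariation_ge0.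
Qed.

Lemma BVp_fineK p a b x : a < b -> BVp N p a b x ->
  (fine (var N p a b x))%:E = var N p a b x.
Proof. by move=> ab xBV; rewrite fineK// ge0_fin_numE// var_ge0. Qed.

Lemma pvariation_le_fine p a b x s : a < b -> BVp N p a b x ->
  itv_partition a b s -> pvariation N p a b x s <= fine (var N p a b x).
Proof.
by move=> ab xBV abs; rewrite -lee_fin BVp_fineK// pvariation_le_var.
Qed.

Lemma var_le p a b x (M : R) :
  (forall s, itv_partition a b s -> pvariation N p a b x s <= M) ->
  (var N p a b x <= M%:E)%E.
Proof.
by move=> H; apply: ge_ereal_sup => _ [s abs <-]; rewrite lee_fin H.
Qed.

Lemma BVp_of_le p a b x (M : R) : (var N p a b x <= M%:E)%E -> BVp N p a b x.
Proof. by move=> xM; rewrite /BVp /=; apply: le_lt_trans xM (ltry _). Qed.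

Lemma fine_var_le p a b x (M : R) : a < b -> (var N p a b x <= M%:E)%E ->
  fine (var N p a b x) <= M.
Proof.
by move=> ab xM; rewrite -lee_fin BVp_fineK//; exact: BVp_of_le xM.
Qed.

(** A single increment is already a term of a variation sum, for the partition
    a < t < b.  The points of a partition are distinct, hence the separate
    treatment of t = a and t = b. *)
Lemma norm_increment_le p a b x t : a < b -> 0 < p -> BVp N p a b x ->
  a <= t <= b -> N (x t - x a) <= fine (var N p a b x) `^ p^-1.
Proof.
move=> ab p0 xBV /andP[].
rewrite le_eqVlt => /predU1P[<- _|at_ tb].
  by rewrite subrr (normN0 normN) powR_ge0.
apply: le_powR_root => //; first exact: normN_ge0.
move: tb; rewrite le_eqVlt => /predU1P[->|tb].
  apply: le_trans (pvariation_le_fine ab xBV (itv_partition1 ab)).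
  by rewrite /pvariation big_nat1/=.
have abs : itv_partition a b [:: t; b] by split; rewrite /= ?at_ ?tb.
apply: le_trans (pvariation_le_fine ab xBV abs).
by rewrite /pvariation big_nat_recl//= lerDl sumr_ge0// => i _; exact: powR_ge0.
Qed.

(** The p-norm dominates the uniform norm. *)
Lemma BVp_norm_ub p a b x t : a < b -> 0 < p -> BVp N p a b x ->
  a <= t <= b -> N (x t) <= BVp_norm N p a b x.
Proof.
move=> ab p0 xBV tab; rewrite -(subrK (x a) (x t)) addrC /BVp_norm.
apply: le_trans (normND normN _ _) _.
by rewrite lerD2l norm_increment_le.
Qed.

(** * Hoelder implies locally bounded *)

(** Raising the Hoelder estimate with exponent p / q to the power q bounds each
    term of a q-variation sum of f o x by L ^ q times the corresponding term
    of the p-variation sum of x. *)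
Lemma var_comp_hoelder p q a b x f r L : a < b -> 0 < p -> 0 < q -> 0 <= L ->
  BVp N p a b x -> BVp_norm N p a b x <= r ->
  (forall u w, N u <= r -> N w <= r -> N (f u - f w) <= L * N (u - w) `^ (p / q)) ->
  (var N q a b (comp_op f x) <= (L `^ q * fine (var N p a b x))%:E)%E.
Proof.
move=> ab p0 q0 L0 xBV xr fL; apply: var_le => s abs.
apply: (@le_trans _ _ (L `^ q * pvariation N p a b x s)); last first.
  by rewrite ler_wpM2l ?powR_ge0// pvariation_le_fine.
rewrite /pvariation mulr_sumr; apply: ler_sum_nat => i /andP[_ si].
have xnth j : (j <= size s)%N -> N (x (nth b (a :: s) j)) <= r.
  move=> js; apply: le_trans (BVp_norm_ub ab p0 xBV _) xr.
  by rewrite (itv_partition_nth_ge _ abs)// (itv_partition_nth_le _ abs).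
apply: le_trans (_ : (L * N (x (nth b (a :: s) i.+1)
                           - x (nth b (a :: s) i)) `^ (p / q)) `^ q <= _).
  apply: le_powR; [exact: ltW|exact: normN_ge0|].
  by apply: fL; apply: xnth => //; exact: ltnW.
by rewrite powRM ?powR_ge0// -powRrM divfK ?lt0r_neq0.
Qed.

Lemma hoelder_locally_bounded p q a b f : a < b -> 0 < p -> 0 < q ->
  (forall r, 0 < r -> exists2 L, 0 <= L & forall u w, N u <= r -> N w <= r ->
    N (f u - f w) <= L * N (u - w) `^ (p / q)) ->
  locally_bounded_op N p q a b (comp_op f).
Proof.
move=> ab p0 q0 fH A [ABV [M AM]].
(* M may fail to be positive, when A is empty or consists of null maps. *)
pose r := Num.max M 1.
have r0 : 0 < r by rewrite lt_max ltr01 orbT.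
have [L L0 fL] := fH r r0.
have Ar x : A x -> BVp_norm N p a b x <= r.
  by move=> /AM xM; rewrite le_max xM.
have varA x : A x ->
    (var N q a b (comp_op f x) <= (L `^ q * fine (var N p a b x))%:E)%E.
  by move=> Ax; apply: (@var_comp_hoelder _ _ _ _ _ _ r) => //;
    [exact: ABV|exact: Ar].
split; first by move=> _ [x Ax <-]; exact: BVp_of_le (varA x Ax).
exists (N (f 0) + L * r `^ (p / q) + L * (r `^ p) `^ q^-1) => _ [x Ax <-].
have xBV := ABV x Ax.
have var0 : 0 <= fine (var N p a b x) by rewrite fine_ge0// var_ge0.
have xar : N (x a) <= r.
  apply: le_trans (BVp_norm_ub ab p0 xBV _) (Ar x Ax).
  by rewrite lexx ltW.
apply: lerD.
  rewrite /comp_op -(subrK (f 0) (f (x a))) addrC.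
  apply: le_trans (normND normN _ _) _; rewrite lerD2l.
  apply: le_trans (fL _ _ xar _) _; first by rewrite (normN0 normN) ltW.
  rewrite subr0 ler_wpM2l// le_powR// ?(normN_ge0 normN)//.
  by rewrite divr_ge0 ?ltW.
apply: le_trans (le_powR _ _ (fine_var_le ab (varA x Ax))) _.
- by rewrite invr_ge0 ltW.
- by rewrite fine_ge0// var_ge0.
rewrite powRM ?powR_ge0// powRK// ?lt0r_neq0// ler_wpM2l//.
apply: le_powR => //; first by rewrite invr_ge0 ltW.
apply: powR_root_le => //; apply: le_trans (Ar x Ax).
by rewrite lerDr (normN_ge0 normN).
Qed.

(** * Zigzag maps *)

(** The position of t in the subdivision of [a, b] into n equal intervals:
    it is monotone on the whole line, hence counts jumps by telescoping. *)
Definition cell n a b (t : R) : nat := Num.truncn (n%:R * ((t - a) / (b - a))).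

Definition zigzag n a b u w (t : R) : E := if odd (cell n a b t) then u else w.

(** The indices start at 1 because [itv_partition] leaves out the left
    endpoint. *)
Definition subdivision n a b : seq R :=
  [seq a + i%:R * ((b - a) / n%:R) | i <- iota 1 n].

Lemma cell_mono n a b s t : a < b -> s <= t -> (cell n a b s <= cell n a b t)%N.
Proof.
move=> ab st; apply: le_truncn; rewrite ler_wpM2l// ler_pM2r ?lerD2r//.
by rewrite invr_gt0 subr_gt0.
Qed.

Lemma cell_left n a b : cell n a b a = 0%N.
Proof. by rewrite /cell subrr mul0r mulr0 truncn0. Qed.

Lemma cell_right n a b : a < b -> cell n a b b = n.
Proof. by move=> ab; rewrite /cell divff ?mulr1 ?natrK// gt_eqF// subr_gt0. Qed.

Lemma cell_node n a b i : a < b -> (0 < n)%N ->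
  cell n a b (a + i%:R * ((b - a) / n%:R)) = i.
Proof.
move=> ab n0; rewrite /cell [a + _]addrC addrK.
have ba : b - a != 0 by rewrite gt_eqF// subr_gt0.
have nn : n%:R != 0 :> R by rewrite pnatr_eq0 -lt0n.
rewrite (_ : n%:R * _ = i%:R) ?natrK//.
by field; apply/andP.
Qed.

Lemma subdivision_partition n a b : a < b -> (0 < n)%N ->
  itv_partition a b (subdivision n a b).
Proof.
move=> ab n0; pose g i := a + i%:R * ((b - a) / n%:R).
have g0 : g 0%N = a by rewrite /g mul0r addr0.
split.
  have : sorted <%R (map g (iota 0 n.+1)).
    apply: (@homo_sorted _ _ g ltn) (iota_ltn_sorted 0 n.+1) => i j ij.
    by rewrite ltrD2l ltr_pM2r ?ltr_nat// divr_gt0 ?subr_gt0 ?ltr0n.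
  by rewrite /= g0.
rewrite /subdivision -[X in last X _]g0 last_map.
case: n n0 @g g0 => // n _ g g0.
rewrite -nth_last size_iota nth_iota// /g mulrC divfK; last first.
  by rewrite pnatr_eq0.
by rewrite addrC subrK.
Qed.

(** An increment of the zigzag is 0 or has norm N (u - w), and in the latter case
    the cell index grows by at least 1; over the whole interval that index
    grows by n. *)
Lemma var_zigzag_le n p a b u w : a < b -> 0 < p ->
  (var N p a b (zigzag n a b u w) <= (n%:R * N (u - w) `^ p)%:E)%E.
Proof.
move=> ab p0; apply: var_le => s abs.
pose c i : R := (cell n a b (nth b (a :: s) i))%:R.
apply: le_trans (_ : \sum_(0 <= i < size s) (c i.+1 - c i) * N (u - w) `^ p <= _).
  rewrite /pvariation; apply: ler_sum_nat => i /andP[_ si].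
  have := cell_mono n ab (ltW ((pathP b abs.1) i si)).
  rewrite /zigzag /c [nth b (a :: s) i.+1]/= leq_eqVlt => /predU1P[->|lt_c].
    by rewrite !subrr (normN0 normN) mul0r powR0// lt0r_neq0.
  apply: le_trans (_ : N (u - w) `^ p <= _).
    apply: le_powR; [exact: ltW|exact: normN_ge0|].
    by case: ifP; case: ifP => _ _;
      rewrite ?subrr ?(normN0 normN) ?(normN_ge0 normN)// -(normNN normN) opprB.
  by rewrite ler_peMl ?powR_ge0// lerBrDr addrC natr1 ler_nat.
rewrite -mulr_suml telescope_sumr// /c (itv_partition_nth_size _ abs)/=.
by rewrite cell_left cell_right// subr0.
Qed.

(** The nodes of the subdivision lie in consecutive cells, so the zigzag
    alternates along them. *)
Lemma pvariation_comp_zigzag n q a b u w f : a < b -> (0 < n)%N ->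
  pvariation N q a b (comp_op f (zigzag n a b u w)) (subdivision n a b)
    = n%:R * N (f u - f w) `^ q.
Proof.
move=> ab n0; have szs : size (subdivision n a b) = n.
  by rewrite size_map size_iota.
have nthE i : (i <= n)%N -> nth b (a :: subdivision n a b) i =
    a + i%:R * ((b - a) / n%:R).
  case: i => [_|i le_in]; first by rewrite mul0r addr0.
  by rewrite /= (nth_map 0%N) ?size_iota// nth_iota.
rewrite /pvariation szs big_nat (eq_bigr (fun=> N (f u - f w) `^ q)); last first.
  move=> i /andP[_ lt_in]; rewrite !nthE// 1?ltnW// /comp_op /zigzag.
  rewrite !cell_node//=; case: (odd i) => //=.
  by rewrite -(normNN normN) opprB.
by rewrite -big_nat sumr_const_nat subn0 mulr_natl.
Qed.

(** * Locally bounded implies Hoelder *)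

(** The integer part n of c / d is at least 1, so that c / d < n + 1 <= 2n. *)
Lemma integer_quotient (c d : R) : 0 < d -> d <= c ->
  exists2 n, (0 < n)%N & n%:R * d <= c <= 2 * (n%:R * d).
Proof.
move=> d0 dc; have c0 := lt_le_trans d0 dc.
have cd0 : 0 <= c / d by rewrite divr_ge0 ?ltW.
have /andP[nle ltn1] := truncn_itv cd0.
have n0 : (0 < Num.truncn (c / d))%N by rewrite truncn_gt0 ler_pdivlMr// mul1r.
exists (Num.truncn (c / d)) => //.
move: nle ltn1; set n := Num.truncn _ in n0 *.
rewrite ler_pdivlMr// ltr_pdivrMr// -natr1 mulrDl mul1r => -> /ltW/le_trans -> //.
by rewrite mulr_natl mulr2n lerD2l ler_peMl ?ler1n// ltW.
Qed.

(** The number of jumps is adapted to the distance of u and w so that all the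
    zigzags lie in the ball of radius 3r, to which local boundedness is applied
    once: the constant must not depend on u and w. *)
Lemma locally_bounded_hoelder p q a b f : a < b -> 0 < p -> 0 < q ->
  locally_bounded_op N p q a b (comp_op f) ->
  forall r, 0 < r -> exists2 L, 0 <= L & forall u w, N u <= r -> N w <= r ->
    N (f u - f w) <= L * N (u - w) `^ (p / q).
Proof.
move=> ab p0 q0 flb r r0.
have [fBV [M fM]] : BVp_bounded N q a b (comp_op f @`
    [set x | BVp N p a b x /\ BVp_norm N p a b x <= 3 * r]).
  by apply: flb; split=> [x []//|]; exists (3 * r) => x [].
pose c := (2 * r) `^ p.
have c0 : 0 < c by rewrite powR_gt0// mulr_gt0.
pose M' := Num.max M 0.
have M0 : 0 <= M' by rewrite le_max lexx orbT.
exists (M' * (2 / c) `^ q^-1); first by rewrite mulr_ge0 ?powR_ge0.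
move=> u w ur wr.
have [->|uw] := eqVneq u w.
  by rewrite !subrr (normN0 normN) !mulr_ge0 ?powR_ge0.
have d0 : 0 < N (u - w).
  rewrite lt_neqAle (normN_ge0 normN) andbT eq_sym.
  by apply: contra uw => /eqP/(normN0_eq0 normN)/eqP; rewrite subr_eq0.
have dr : N (u - w) <= 2 * r.
  apply: le_trans (normND normN _ _) _.
  by rewrite (normNN normN) mulr_natl mulr2n lerD.
have [n n0 /andP[nc cn]] := integer_quotient (powR_gt0 p d0)
  (le_powR (ltW p0) (ltW d0) dr : _ <= c).
pose x := zigzag n a b u w.
have xvar : (var N p a b x <= c%:E)%E.
  by apply: le_trans (var_zigzag_le n u w ab p0) _; rewrite lee_fin.
have xBV := BVp_of_le xvar.
have xnorm : BVp_norm N p a b x <= 3 * r.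
  (* r bounds the value at a, and 2r is the p-th root of c. *)
  have -> : 3 * r = r + 2 * r by lra.
  apply: lerD.
    by rewrite /x /zigzag; case: ifP.
  have r2 : 0 <= 2 * r by rewrite mulr_ge0// ltW.
  rewrite -[leRHS](powRK r2 (lt0r_neq0 p0)).
  apply: le_powR; first by rewrite invr_ge0 ltW.
    by rewrite fine_ge0// var_ge0.
  exact: fine_var_le.
have fxA : (comp_op f @` [set x | BVp N p a b x /\ BVp_norm N p a b x <= 3 * r])
  (comp_op f x) by exists x.
have fxBV := fBV _ fxA.
have fxM : n%:R * N (f u - f w) `^ q <= M' `^ q.
  rewrite -(pvariation_comp_zigzag q u w f ab n0).
  apply: le_trans (pvariation_le_fine ab fxBV (subdivision_partition ab n0)) _.
  apply: powR_root_le => //; first by rewrite fine_ge0// var_ge0.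
  rewrite le_max; apply/orP; left; apply: le_trans (fM _ fxA).
  by rewrite lerDr (normN_ge0 normN).
apply: (le_powR_cancel q0); rewrite ?(normN_ge0 normN)//.
  by rewrite !mulr_ge0 ?powR_ge0.
have c2 : 0 <= 2 / c by rewrite divr_ge0 ?ltW.
rewrite powRM ?mulr_ge0 ?powR_ge0// powRM ?powR_ge0//.
rewrite (powRVK c2 (lt0r_neq0 q0)) -powRrM divfK ?lt0r_neq0//.
rewrite [X in _ <= X * _]mulrA [X in _ <= X]mulrAC ler_pdivlMr//.
apply: le_trans (ler_wpM2l (powR_ge0 _ _) cn) _.
have := ler_wpM2r (ltW (mulr_gt0 (ltr0n R 2) (powR_gt0 p d0))) fxM.
lra.
Qed.

End Variation.

(** * The real and the complex case *)

(** Passage from balls of the norm N to the bounded sets of the topology of E,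
    whose definition quantifies over the scalar field K. *)
Lemma locally_bounded_hoelderP (R : realType) (K : numFieldType)
    (E : normedModType K) (N : E -> R) (a b p q : R) (f : E -> E) :
  is_norm N ->
  (forall A : set E,
    bounded_set A <-> exists2 r, 0 < r & forall v, A v -> N v <= r) ->
  a < b -> 0 < p -> 0 < q ->
  locally_bounded_op N p q a b (comp_op f) <-> hoelder_on_bounded N (p / q) f.
Proof.
move=> normN bndP ab p0 q0; split=> [flb A /bndP[r r0 Ar]|fH].
  have [L L0 fL] := locally_bounded_hoelder normN ab p0 q0 flb r0.
  by exists L => // u w /Ar ur /Ar wr; exact: fL.
apply: hoelder_locally_bounded => // r r0.
have [|L L0 fL] := fH [set v | N v <= r]; first by apply/bndP; exists r.
by exists L => // u w ur wr; exact: fL.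
Qed.

Lemma norm_real_is_norm (R : realType) (E : normedModType R) :
  is_norm (@norm_real R E).
Proof.
split; rewrite /norm_real.
- exact: normr0.
- exact: normr0_eq0.
- by move=> v; exact: normr_ge0.
- exact: normrN.
- exact: ler_normD.
Qed.

Lemma bounded_set_norm_real (R : realType) (E : normedModType R) (A : set E) :
  bounded_set A <-> exists2 r, 0 < r & forall v, A v -> norm_real v <= r.
Proof.
split=> [[M [_ AM]]|[r _ Ar]].
  exists (Num.max (M + 1) 1); first by rewrite lt_max ltr01 orbT.
  by move=> v /(AM (M + 1) (ltr_pwDr ltr01 (lexx M))) vM; rewrite le_max vM.
exists r; split=> [|M rM v Av]; first exact: num_real.
exact: le_trans (Ar v Av) (ltW rM).
Qed.

(** A norm with values in R[i] is nonnegative, hence has no imaginary part. *)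
Lemma norm_complexE (R : realType) (E : normedModType R[i]) (v : E) :
  `|v| = (norm_complex v)%:C%C.
Proof.
have := normr_ge0 v; rewrite lecE => /andP[/eqP im0 _].
by rewrite /norm_complex; case: `|v| im0 => /= ? ? ->.
Qed.

Lemma norm_complex_is_norm (R : realType) (E : normedModType R[i]) :
  is_norm (@norm_complex R E).
Proof.
split.
- by rewrite /norm_complex normr0.
- by move=> v v0; apply: normr0_eq0; rewrite norm_complexE v0.
- by move=> v; have := normr_ge0 v; rewrite lecE => /andP[].
- by move=> v; rewrite /norm_complex normrN.
- move=> u v; have := ler_normD u v; rewrite lecE => /andP[_].
  by rewrite /norm_complex raddfD.
Qed.

Lemma bounded_set_norm_complex (R : realType) (E : normedModType R[i])
    (A : set E) :
  bounded_set A <-> exists2 r, 0 < r & forall v, A v -> norm_complex v <= r.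
Proof.
split=> [[M [_ AM]]|[r r0 Ar]].
  exists (Num.max (complex.Re (M + 1)) 1); first by rewrite lt_max ltr01 orbT.
  move=> v /(AM (M + 1) (ltr_pwDr ltr01 (lexx M))) /=.
  by rewrite lecE => /andP[_ vM]; rewrite le_max vM.
exists r%:C%C; split=> [|M rM v Av /=].
  by rewrite ger0_real// lecR ltW.
by rewrite norm_complexE; apply: le_trans (ltW rM); rewrite lecR Ar.
Qed.

Theorem theorem6 (R : realType) (a b p q : R)
    (hab : a < b) (hp : 1 <= p) (hpq : p <= q) :
  (forall (E : normedModType R) (f : E -> E),
     (forall x : R -> E, BVp (@norm_real R E) p a b x ->
        BVp (@norm_real R E) q a b (comp_op f x)) ->
     (locally_bounded_op (@norm_real R E) p q a b (comp_op f) <->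
      hoelder_on_bounded (@norm_real R E) (p / q) f)) /\
  (forall (E : normedModType R[i]) (f : E -> E),
     (forall x : R -> E, BVp (@norm_complex R E) p a b x ->
        BVp (@norm_complex R E) q a b (comp_op f x)) ->
     (locally_bounded_op (@norm_complex R E) p q a b (comp_op f) <->
      hoelder_on_bounded (@norm_complex R E) (p / q) f)).
Proof.
have p0 : 0 < p by exact: lt_le_trans ltr01 hp.
have q0 : 0 < q by exact: lt_le_trans p0 hpq.
split=> E f _; apply: locally_bounded_hoelderP => //.
- exact: norm_real_is_norm.
- exact: bounded_set_norm_real.
- exact: norm_complex_is_norm.
- exact: bounded_set_norm_complex.
Qed.
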